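(* Let $c:=\ln(4/3)$. For every integer $n\ge 1$ and every real $p$ with $1>p\ge c/n$, if $X$ is a random variable having the binomial distribution with parameters $n$ and $p$, then $$\mathsf{P}(X>\mathsf{E}X)\ge \tfrac14 .$$ Moreover, for such $n$ and $p$ (that is, under the condition $1>p\ge c/n$), the equality $\mathsf{P}(X>\mathsf{E}X)=\tfrac14$ is attained only if $n=2$ and $p=1/2$. Furthermore, the constant factor $c$ in the condition $1>p\ge c/n$ is the best possible: for every real $c_1<c$ there exist an integer $n\ge1$ and a real $p\in[0,1)$ with $p\ge c_1/n$ such that a binomial random variable $X$ with parameters $n$ and $p$ satisfies $\mathsf{P}(X>\mathsf{E}X)<\tfrac14$.
   Context: A random variable $X$ has the binomial distribution with parameters $n$ and $p$ if $\mathsf{P}(X=k)=\binom nk p^k(1-p)^{n-k}$ for $k=0,1,\dots,n$; its expectation is $\mathsf{E}X=np$. *)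

(* Defs.v *)
From HB Require Import structures.
From mathcomp Require Import all_boot all_order all_algebra.
From mathcomp Require Import all_classical all_reals all_analysis.
Set Implicit Arguments.
Unset Strict Implicit.
Unset Printing Implicit Defensive.
Import Order.TTheory GRing.Theory Num.Theory.
Import numFieldNormedType.Exports.
Local Open Scope classical_set_scope.
Local Open Scope ring_scope.

(* X is real-valued, so that 'E_P[X] and P (X > 'E_P[X]) are the library's
   notions.  The masses at 0, ..., n sum to 1, so they determine the law. *)
Definition binomially_distributed (R : realType) (d : measure_display)
    (T : measurableType d) (P : probability T R) (X : {RV P >-> R})
    (n : nat) (p : R) : Prop :=
  forall k : nat, (k <= n)%N ->
    P [set t | X t = k%:R] = (binomial_pmf n p k)%:E.

(* Main.v *)
Require Import Defs.
From HB Require Import structures.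
From mathcomp Require Import all_boot all_order all_algebra.
From mathcomp Require Import all_classical all_reals all_analysis.
From mathcomp Require Import measurable_realfun.
From mathcomp Require Import ring lra.
Import Order.TTheory GRing.Theory Num.Theory.
Import numFieldNormedType.Exports.
Local Open Scope classical_set_scope.
Local Open Scope ring_scope.

(* If [k <= n p < k + 1], then [P (X > E X) = 1 - P (Bin(n, p) <= k)] increases
   with [p].  For [k = 0] the condition [p >= c / n] gives
   [1 - (1 - p)^n > 1 - exp (- c) = 1/4].  For [k >= 1] it suffices to treat
   [p = k / n].  By a Hoeffding-type equalisation argument, adding a trial of
   parameter 0 to [Bin(n, k / n)] and then moving all the parameters to
   [k / (n + 1)] decreases [P (. <= k)], so the extremal case is [n = k + 1],
   where the probability is [(k / (k + 1))^(k + 1)]; this increases with [k] and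
   equals [1/4] at [k = 1]. *)

(** * Recurrences for binomial masses and their derivatives in the success parameter *)

Section binomial_pmf_calculus.
Context {R : realType}.
Implicit Types (n k : nat) (x : R).

Definition binomial_cdf n x k : R := \sum_(j < k.+1) binomial_pmf n x j.

Lemma binomial_pmfE n x k :
  binomial_pmf n x k = 'C(n, k)%:R * (x ^+ k * (1 - x) ^+ (n - k)).
Proof. by rewrite mulr_natl. Qed.

Lemma binomial_pmf0 n x : binomial_pmf n x 0 = (1 - x) ^+ n.
Proof. by rewrite binomial_pmfE bin0 subn0 !mul1r. Qed.

Lemma binomial_pmfS n x k : binomial_pmf n.+1 x k.+1 =
  x * binomial_pmf n x k + (1 - x) * binomial_pmf n x k.+1.
Proof.
rewrite !binomial_pmfE binS natrD subSS exprS.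
have [kn|nk] := ltnP k n; last by rewrite bin_small//; ring.
by rewrite -(subnSK kn) exprS; ring.
Qed.

Lemma binomial_cdf0 n x : binomial_cdf n x 0 = (1 - x) ^+ n.
Proof. by rewrite /binomial_cdf big_ord1 binomial_pmf0. Qed.

Lemma binomial_cdf_recr n x k :
  binomial_cdf n x k.+1 = binomial_cdf n x k + binomial_pmf n x k.+1.
Proof. exact: big_ord_recr. Qed.

(** One more trial pushes the count above [k] exactly when the first [n] trials give [k] successes
    and the new one succeeds. *)
Lemma binomial_cdfS n x k :
  binomial_cdf n.+1 x k = binomial_cdf n x k - x * binomial_pmf n x k.
Proof.
elim: k => [|k IHk]; first by rewrite !binomial_cdf0 binomial_pmf0 exprS; ring.
by rewrite !binomial_cdf_recr IHk binomial_pmfS; ring.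
Qed.

Lemma binomial_cdfnn n x : binomial_cdf n x n = 1.
Proof.
rewrite -(expr1n _ n) -[in RHS](subrK x 1) exprDn.
by apply: eq_bigr => i _; rewrite mulrC.
Qed.

Lemma mul_binomial_pmf n x k : k.+1%:R * binomial_pmf n.+1 x k.+1 =
  n.+1%:R * x * binomial_pmf n x k.
Proof.
have /(congr1 (fun m => m%:R : R)) := mul_bin_diag n.+1 k.
rewrite !natrM /= => E.
by rewrite !binomial_pmfE mulrA -E subSS exprS; ring.
Qed.

Lemma mean_binomial_pmf n x :
  \sum_(j < n.+1) j%:R * binomial_pmf n x j = n%:R * x.
Proof.
case: n => [|n]; first by rewrite big_ord1 !mul0r.
rewrite big_ord_recl mul0r add0r -[RHS]mulr1.
rewrite -[X in _ = _ * X](binomial_cdfnn n x).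
by rewrite mulr_sumr; apply: eq_bigr => i _; rewrite -mul_binomial_pmf.
Qed.

Lemma binomial_pmf_gt0 n x k : (k <= n)%N -> 0 < x -> x < 1 ->
  0 < binomial_pmf n x k.
Proof.
move=> kn x0 x1; rewrite binomial_pmfE.
by rewrite !mulr_gt0 ?ltr0n ?bin_gt0 ?exprn_gt0 ?subr_gt0.
Qed.

(** For [a = 0] or [b = 0] the truncated predecessor is harmless, since its coefficient vanishes. *)
Lemma is_derive_exp_onem (a b : nat) x :
  is_derive x 1 (fun y => y ^+ a * (1 - y) ^+ b)
    (a%:R * (x ^+ a.-1 * (1 - x) ^+ b) - b%:R * (x ^+ a * (1 - x) ^+ b.-1)).
Proof.
have := is_derive_poly ('X^a * (1 - 'X) ^+ b) x.
rewrite (_ : horner _ = fun y => y ^+ a * (1 - y) ^+ b); last first.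
  by apply/funext => y; rewrite !hornerE.
move=> /is_derive_eq; apply.
rewrite derivM derivXn deriv_exp derivB derivC derivX sub0r mulN1r hornerD.
rewrite !hornerM !hornerMn hornerN !horner_exp hornerD hornerN hornerC !hornerX.
by ring.
Qed.

Lemma is_derive_binomial_pmfS n x k :
  is_derive x 1 (fun y => binomial_pmf n.+1 y k.+1)
    (n.+1%:R * (binomial_pmf n x k - binomial_pmf n x k.+1)).
Proof.
rewrite (_ : (fun _ => _) =
    'C(n.+1, k.+1)%:R *: (fun y => y ^+ k.+1 * (1 - y) ^+ (n - k)));
  last by apply/funext => y; rewrite binomial_pmfE subSS.
apply: (is_derive_eq (is_deriveZ _ (is_derive_exp_onem _ _ _))).
rewrite !binomial_pmfE/= -[_ *: _]/(_ * _) subnS.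
have /(congr1 (fun m => m%:R : R)) := mul_bin_diag n.+1 k.
have /(congr1 (fun m => m%:R : R)) := mul_bin_left n k.
rewrite !natrM/= => E1 E2.
(* Both terms are regrouped so that [E2] lowers ['C(n.+1, k.+1)] to ['C(n, k)]; then [E1] turns the
   second one into ['C(n, k.+1)]. *)
transitivity (k.+1%:R * 'C(n.+1, k.+1)%:R * (x ^+ k * (1 - x) ^+ (n - k))
   - k.+1%:R^-1 * (n - k)%:R * (k.+1%:R * 'C(n.+1, k.+1)%:R)
      * (x ^+ k.+1 * (1 - x) ^+ (n - k).-1)); first by field.
rewrite -E2.
transitivity (n.+1%:R * 'C(n, k)%:R * (x ^+ k * (1 - x) ^+ (n - k))
   - k.+1%:R^-1 * n.+1%:R * ((n - k)%:R * 'C(n, k)%:R)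
      * (x ^+ k.+1 * (1 - x) ^+ (n - k).-1)); first by field.
by rewrite -E1; field.
Qed.

(** The derivatives of the masses are differences of consecutive masses, so their sum telescopes. *)
Lemma is_derive_binomial_cdf n x k :
  is_derive x 1 (fun y => binomial_cdf n.+1 y k)
    (- (n.+1%:R * binomial_pmf n x k)).
Proof.
elim: k => [|k IHk].
  rewrite (_ : (fun _ => _) = fun y => y ^+ 0 * (1 - y) ^+ n.+1); last first.
    by apply/funext => y; rewrite binomial_cdf0 mul1r.
  apply: (is_derive_eq (is_derive_exp_onem _ _ _)).
  by rewrite binomial_pmf0 mul0r mul1r sub0r.
under eq_fun do rewrite binomial_cdf_recr.
apply: (is_derive_eq (is_deriveD IHk (is_derive_binomial_pmfS n x k))).
by ring.
Qed.
End binomial_pmf_calculus.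

(** * Monotonicity of the distribution function in the parameter and in the number of trials *)

Lemma gtr0_is_derive_lt {R : realType} (f df : R -> R) (a b : R) : a < b ->
  (forall x : R, is_derive x 1 f (df x)) ->
  (forall x, a < x < b -> 0 < df x) -> f a < f b.
Proof.
move=> ab fdf df_gt0.
have fab : {within `[a, b], continuous f}.
  by apply: derivable_within_continuous => x _; apply: ex_derive.
have [c] := MVT ab (fun x _ => fdf x) fab.
rewrite in_itv/= => cab E.
by rewrite -subr_gt0 E mulr_gt0 ?subr_gt0 ?df_gt0.
Qed.

Section binomial_cdf_monotonicity.
Context {R : realType}.
Implicit Types (n k : nat) (x y : R).

Lemma binomial_cdf_decr n k x y : (k < n)%N -> 0 <= x -> x < y -> y <= 1 ->
  binomial_cdf n y k < binomial_cdf n x k.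
Proof.
case: n => // n kn x0 xy y1; rewrite -ltrN2.
apply: (@gtr0_is_derive_lt _ (fun z => - binomial_cdf n.+1 z k)
  (fun z => n.+1%:R * binomial_pmf n z k)) => // z.
  by rewrite -[X in is_derive _ _ _ X]opprK; apply/is_deriveN/is_derive_binomial_cdf.
move=> /andP[xz zy]; rewrite mulr_gt0 ?ltr0n// binomial_pmf_gt0//.
  exact: le_lt_trans xz.
exact: lt_le_trans y1.
Qed.

Lemma binomial_pmf_ratio n k x : k.+1%:R * (1 - x) * binomial_pmf n x k.+1 =
  (n - k)%:R * x * binomial_pmf n x k.
Proof.
have /(congr1 (fun m => m%:R : R)) := mul_bin_left n k.
rewrite !natrM !binomial_pmfE => E.
have [kn|nk] := ltnP k n; last by rewrite bin_small// (eqP nk); ring.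
transitivity (k.+1%:R * 'C(n, k.+1)%:R *
    (x ^+ k.+1 * ((1 - x) * (1 - x) ^+ (n - k.+1)))); first by ring.
by rewrite E -exprS subnSK// exprS; ring.
Qed.

(** Past the mode the masses decrease: [(n - k) * x < k.+1 * (1 - x)] is a rearrangement of the last
    hypothesis. *)
Lemma binomial_pmf_lt n k x : (k < n)%N -> 0 < x -> x < 1 ->
  n.+1%:R * x < k.+1%:R -> binomial_pmf n x k.+1 < binomial_pmf n x k.
Proof.
move=> kn x0 x1 nxk.
have pk : 0 < binomial_pmf n x k by rewrite binomial_pmf_gt0// ltnW.
have k1x : 0 < k.+1%:R * (1 - x) by rewrite mulr_gt0 ?ltr0n ?subr_gt0.
rewrite -(ltr_pM2l k1x) binomial_pmf_ratio ltr_pM2r//.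
by rewrite natrB ?(ltnW kn)//; move: nxk; rewrite -!natr1; lra.
Qed.

Lemma binomial_cdf_mean_decr n k : (0 < k < n)%N ->
  binomial_cdf n.+1 (k%:R / n.+1%:R) k < binomial_cdf n (k%:R / n%:R : R) k.
Proof.
case: n => [|n]; first by rewrite andbF.
case: k => // k kn.
(* [G x] is the probability that a sum of [n.+1] Bernoulli variables of
   parameter [x] and one of parameter [k.+1 - n.+1 * x] is at most [k.+1]. *)
pose G x := binomial_cdf n.+1 x k.+1
  - (k.+1%:R - n.+1%:R * x) * binomial_pmf n.+1 x k.+1.
have n1 : (n.+1%:R : R) != 0 by rewrite pnatr_eq0.
have n2 : (n.+2%:R : R) != 0 by rewrite pnatr_eq0.
have n1_gt0 : 0 < n.+1%:R :> R by rewrite ltr0n.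
have n2_gt0 : 0 < n.+2%:R :> R by rewrite ltr0n.
(* The two sides are values of [G]: at [k.+1 / n.+2] the extra variable has parameter [x] as well,
   and at [k.+1 / n.+1] it has parameter 0. *)
rewrite binomial_cdfS.
rewrite [X in X < _](_ : _ = G (k.+1%:R / n.+2%:R)); last first.
  by rewrite /G; congr (_ - _ * _); move: n2; rewrite -(natr1 n.+1) => n2; field.
rewrite [X in _ < X](_ : _ = G (k.+1%:R / n.+1%:R)); last by rewrite /G; field.
apply: (@gtr0_is_derive_lt _ _ (fun x => n.+1%:R *
  ((n.+2%:R * x - k.+1%:R) * (binomial_pmf n x k - binomial_pmf n x k.+1)))).
- by rewrite ltr_pM2l ?ltr0n// ltf_pV2 ?posrE// ltr_nat.
- move=> x.
  have L : is_derive x 1 (fun y : R => k.+1%:R - n.+1%:R * y) (- n.+1%:R).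
    have := is_deriveB (is_derive_cst (k.+1%:R : R) x 1)
      (is_deriveZ n.+1%:R (is_derive_id x 1)).
    by move=> /is_derive_eq; apply; rewrite sub0r -[_ *: _]/(_ * _) mulr1.
  apply: (is_derive_eq (is_deriveB (is_derive_binomial_cdf n x k.+1)
    (is_deriveM L (is_derive_binomial_pmfS n x k)))).
  by rewrite -![_ *: _]/(_ * _) binomial_pmfS -(natr1 n.+1); ring.
(* The left endpoint makes [n.+2 * x - k.+1] positive; the right one puts [k.+1] past the mode, so
   the difference of masses is positive too. *)
- move=> x; rewrite ltr_pdivrMr// ltr_pdivlMr// => /andP[kx xk].
  have x0 : 0 < x by rewrite -(pmulr_lgt0 _ n2_gt0) (lt_trans _ kx).
  have x1 : x < 1.
    by rewrite -(ltr_pM2r n1_gt0) mul1r (lt_trans xk)// ltr_nat.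
  rewrite !mulr_gt0// subr_gt0; first by rewrite mulrC.
  by apply: binomial_pmf_lt => //; rewrite mulrC.
Qed.

End binomial_cdf_monotonicity.

(** * The lower bound 1/4 for the upper tail, with its equality case *)

Section quarter.
Context {R : realType}.
Implicit Types (n k : nat) (p x : R).

Lemma bernoulli_ineq n x : 0 <= x -> 1 + n%:R * x <= (1 + x) ^+ n.
Proof.
move=> x0; elim: n => [|n IHn]; first by rewrite mul0r addr0 expr0.
rewrite exprS -(@ler_pM2l _ (1 + x)) in IHn *; last by lra.
apply: le_trans IHn; rewrite -natr1.
have : 0 <= n%:R * (x * x) :> R by rewrite !mulr_ge0.
by lra.
Qed.

(** The ratio of the two bases is [1 + s] with [s = 1 / (t * (t + 2))]. Bernoulli's inequality
    bounds the quotient of the two sides below by [t / (t + 1) * (1 + s) * (1 + (t + 1) * s)], which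
    equals [1 + 1 / (t * (t + 2) ^+ 2)]. *)
Lemma expr_ratio_lt k : (0 < k)%N ->
  (k%:R / k.+1%:R : R) ^+ k.+1 < (k.+1%:R / k.+2%:R) ^+ k.+2.
Proof.
move=> k0; have kp : 0 < k%:R :> R by rewrite ltr0n.
rewrite -(natr1 k.+1) -(natr1 k); set t : R := k%:R in kp *.
have := @bernoulli_ineq k.+1 ((t * (t + 2))^-1).
rewrite invr_ge0 -(natr1 k) -/t => /(_ ltac:(nra)) B.
rewrite [ltRHS]exprS.
rewrite (_ : (t + 1) / (t + 1 + 1) = t / (t + 1) * (1 + (t * (t + 2))^-1)); last first.
  by field; apply/and3P; split; apply: lt0r_neq0; lra.
rewrite [X in _ < _ * X]exprMn.
set u := (t / (t + 1)) ^+ _; set v := (1 + _) ^+ _ in B *.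
have u0 : 0 < u by rewrite exprn_gt0// divr_gt0//; lra.
rewrite mulrCA ltr_pMr//.
apply: (@lt_le_trans _ _ (t / (t + 1) * (1 + (t * (t + 2))^-1) *
    (1 + (t + 1) * (t * (t + 2))^-1))); last first.
  rewrite ler_pM2l; first exact: B.
  by rewrite mulr_gt0 ?divr_gt0 ?addr_gt0 ?invr_gt0 ?mulr_gt0 ?addr_gt0.
rewrite (_ : _ * _ * _ = 1 + (t * (t + 2) ^+ 2)^-1).
  by rewrite ltrDl invr_gt0 mulr_gt0// exprn_gt0//; lra.
by field; apply/and3P; split; apply: lt0r_neq0; lra.
Qed.

Lemma expr_ratio_gt_quarter k : (1 < k)%N -> 1 / 4 < (k%:R / k.+1%:R : R) ^+ k.+1.
Proof.
elim: k => // -[|k] //; case: k => [_ _|k IHk _].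
  (* At [k = 1] the power is exactly 1/4, so the case [k = 2] is already strict. *)
  by apply: le_lt_trans (expr_ratio_lt 1 isT); rewrite expr2; lra.
by apply: lt_trans (IHk isT) _; exact: expr_ratio_lt.
Qed.

Lemma binomial_upper_tail_last n p : 1 - binomial_cdf n.+1 p n = p ^+ n.+1.
Proof.
rewrite -(binomial_cdfnn n.+1 p) binomial_cdf_recr addrC addKr.
by rewrite binomial_pmfE binn subnn expr0 mulr1 mul1r.
Qed.

(** Induction on [n] from [k.+1]: each further trial strictly raises the tail, hence equality only
    at the start. *)
Lemma binomial_upper_tail_mean_ge k n : (0 < k < n)%N ->
  (k%:R / k.+1%:R : R) ^+ k.+1 <= 1 - binomial_cdf n (k%:R / n%:R) k
    ?= iff (n == k.+1).
Proof.
move=> /andP[k0]; elim: n => // n IHn; rewrite ltnS leq_eqVlt.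
move=> /orP[/eqP <-|kn].
  by rewrite eqxx binomial_upper_tail_last; split; rewrite ?eqxx.
have {}IHn := IHn kn.
have lt : (k%:R / k.+1%:R : R) ^+ k.+1 < 1 - binomial_cdf n.+1 (k%:R / n.+1%:R) k.
  apply: le_lt_trans (leif_le IHn) _.
  by rewrite ltrD2l ltrN2 binomial_cdf_mean_decr// k0.
split; first exact: ltW.
by rewrite (lt_eqF lt) eqSS gtn_eqF.
Qed.

Lemma binomial_upper_tail_mean_quarter k n : (0 < k < n)%N ->
  1 / 4 <= 1 - binomial_cdf n (k%:R / n%:R : R) k ?= iff (n == 2)%N.
Proof.
move=> kn; have := binomial_upper_tail_mean_ge _ _ kn; case/andP: kn => k0 kn.
have [k1 H|] := ltnP 1 k.
  have lt := lt_le_trans (expr_ratio_gt_quarter _ k1) (leif_le H).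
  split; first exact: ltW.
  by rewrite (lt_eqF lt) gtn_eqF// (leq_trans _ kn).
move=> k1; have -> : k = 1%N by apply/eqP; rewrite eqn_leq k1.
by rewrite (_ : (1%:R / 2%:R : R) ^+ 2 = 1 / 4)//; rewrite expr2; lra.
Qed.

Lemma binomial_upper_tail_quarter n p k : (0 < n)%N -> ln (4 / 3) / n%:R <= p ->
  p < 1 -> k%:R <= n%:R * p < k.+1%:R ->
  1 / 4 <= 1 - binomial_cdf n p k /\
  (1 - binomial_cdf n p k = 1 / 4 -> n = 2%N /\ p = 1 / 2).
Proof.
move=> n0 cp p1 /andP[kp pk].
have nR : 0 < n%:R :> R by rewrite ltr0n.
have kn : (k < n)%N.
  by rewrite -(ltr_nat R) (le_lt_trans kp)// gtr_pMr.
case: k => [|k] in kp pk kn *.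
  suff lt : 1 / 4 < 1 - binomial_cdf n p 0.
    by split; [exact: ltW|move=> E; rewrite E ltxx in lt].
  have p0 : 0 < p by apply: lt_le_trans cp; rewrite divr_gt0 ?ln_gt0//; lra.
  suff : (1 - p) ^+ n < 3 / 4 by rewrite binomial_cdf0; lra.
  (* Strict because [p] is nonzero; this excludes equality when [k = 0]. *)
  have : (1 - p) ^+ n < expR (- p) ^+ n.
    rewrite ltrXn2r ?lt0n_neq0 ?subr_ge0 ?ltW ?expR_gt0//.
    by rewrite expR_gt1Dx// oppr_eq0 gt_eqF.
  move=> /lt_le_trans; apply; rewrite -expRM_natr.
  rewrite -[leRHS]lnK ?posrE; last by lra.
  rewrite ler_expR (_ : 3 / 4 = (4 / 3)^-1); last by field.
  rewrite lnV ?posrE; last by lra.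
  by rewrite mulNr lerN2 -ler_pdivrMr.
have H := @binomial_upper_tail_mean_quarter k.+1 n; rewrite kn in H.
have {}H := H isT.
(* Equality can occur only at [p = k.+1 / n]; there [n = 2] forces [k.+1 = 1]. A larger [p] gives a
   strictly larger tail. *)
have := kp; rewrite mulrC -ler_pdivrMr// le_eqVlt => /orP[/eqP<-|lt].
  split; first exact: leif_le H.
  move=> /esym/eqP; rewrite H => /eqP n2; split=> //.
  by move: kn; rewrite n2; case: (k).
have : 1 - binomial_cdf n (k.+1%:R / n%:R) k.+1 < 1 - binomial_cdf n p k.+1.
  by rewrite ltrD2l ltrN2 binomial_cdf_decr// ?ltW ?divr_ge0 ?ler0n.
move=> /(le_lt_trans (leif_le H)) {}lt.
by split; [exact: ltW|move=> E; rewrite E ltxx in lt].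
Qed.

End quarter.

(** * Probabilities and expectation of a binomially distributed random variable *)

Section binomial_law.
Context {R : realType} {d : measure_display} {T : measurableType d}
  (P : probability T R) (X : {RV P >-> R}) (n : nat) (p : R).
Hypothesis XB : binomially_distributed X n p.

Local Notation fiber j := (X @^-1` [set j%:R]).

Let measurable_fiber j : measurable (fiber j).
Proof. exact: measurable_funPTI. Qed.

Let trivIset_fiber : trivIset setT (fun j => fiber j).
Proof.
by move=> i j _ _ [t [/= -> /eqP]]; rewrite eqr_nat => /eqP.
Qed.

Let support := \bigcup_(j in `I_n.+1) fiber j.

Let measurable_support : measurable support.
Proof. exact: bigcup_measurable. Qed.

Let P_fiber (j : 'I_n.+1) : P (fiber j) = (binomial_pmf n p j)%:E.
Proof. by rewrite -XB// -ltnS. Qed.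

(** The fibers are disjoint and their masses already sum to 1. *)
Let P_supportC : P (~` support) = 0%E.
Proof.
rewrite probability_setC// /support bigcup_mkord.
rewrite (@measure_bigsetU _ _ _ P (fun j => fiber j))//.
rewrite (eq_bigr _ (fun j _ => P_fiber j)).
by rewrite sumEFin -/(binomial_cdf n p n) binomial_cdfnn subee.
Qed.

Lemma binomial_preimage (B : set R) : measurable B ->
  P (X @^-1` B) = (\sum_(j < n.+1) \1_B j%:R * binomial_pmf n p j)%:E.
Proof.
move=> mB; have mXB : measurable (X @^-1` B) by exact: measurable_funPTI.
rewrite -(setIT (X @^-1` B)) -(setUv support) setIUr measureU//; first last.
- by rewrite setIACA setICr setI0.
- exact/measurableI/measurableC.
- exact: measurableI.
rewrite [X in (_ + X)%E](subset_measure0 _ _ (@subIsetr _ _ _) P_supportC)//;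
  last 2 first.
  exact/measurableI/measurableC.
  exact: measurableC.
rewrite adde0 setI_bigcupr bigcup_mkord.
rewrite (@measure_bigsetU _ _ _ P (fun j => X @^-1` B `&` fiber j))//; last first.
  exact: trivIset_setIl.
rewrite -sumEFin; apply: eq_bigr => j _; rewrite indicE EFinM -P_fiber.
case: (boolP (_ \in B)) => jB.
  rewrite mul1e; congr (P _); apply: setIidr => t /= ->; exact/set_mem.
rewrite mul0e (_ : _ `&` _ = set0) ?measure0//.
apply/seteqP; split => // t /= [+ tj]; rewrite tj => /mem_set.
by apply/negP.
Qed.

Lemma binomial_expectation : ('E_P[X] = (n%:R * p)%:E)%E.
Proof.
(* [g] is a nonnegative simple function equal to [X] on [support], hence almost everywhere, so the
   integral becomes a finite sum. *)
pose g (t : T) : \bar R := (\sum_(j < n.+1) (j%:R * (\1_(fiber j) t : R))%:E)%E.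
have mg (j : nat) :
    measurable_fun setT (EFin \o (fun t => j%:R * (\1_(fiber j) t : R))).
  by apply/measurable_EFinP/measurable_funM => //; exact: measurable_indic.
rewrite expectation_def (ae_eq_integral g)//; first last.
- exists (~` support); split => //; first exact: measurableC.
  move=> t /= tg [j /= jn Xt]; apply: tg => _.
  rewrite /g (bigD1 (Ordinal jn))//= big1 ?adde0; last first.
    move=> i ij; rewrite indicE memNset ?mulr0//= Xt => /eqP.
    rewrite eqr_nat eq_sym => /eqP ji.
    by move: ij; rewrite -(inj_eq val_inj)/= ji eqxx.
  by rewrite indicE mem_set//= mulr1 Xt.
- by apply: emeasurable_sum => j; exact: mg.
- exact/measurable_EFinP.
rewrite /g ge0_integral_sum//; last first.
  by move=> j; exact: mg.
rewrite -mean_binomial_pmf -sumEFin; apply: eq_bigr => j _.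
rewrite (integralZl_indic _ (fun=> fiber j))//; last by rewrite ltrn0.
by rewrite integral_indic// setIT EFinM -P_fiber.
Qed.

(** Since [k] is the integer part of the mean, an integer value exceeds the mean exactly when it
    exceeds [k]. *)
Lemma binomial_exceeds_mean k : (k <= n)%N -> k%:R <= n%:R * p < k.+1%:R ->
  P [set t | ('E_P[X] < (X t)%:E)%E] = (1 - binomial_cdf n p k)%:E.
Proof.
move=> kn /andP[kp pk].
rewrite (_ : [set t | _] = X @^-1` `]n%:R * p, +oo[%classic); last first.
  by apply/seteqP; split => t /=; rewrite binomial_expectation lte_fin in_itv/= andbT.
rewrite binomial_preimage//; congr _%:E.
have step (j : nat) : \1_`]n%:R * p, +oo[%classic j%:R = (k < j)%:R :> R.
  rewrite indicE; have [kj|jk] := ltnP k j.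
    by rewrite mem_set//= in_itv/= andbT (lt_le_trans pk)// ler_nat.
  rewrite memNset//= in_itv/= andbT => /lt_geF.
  by rewrite (le_trans _ kp)// ler_nat.
apply/esym/eqP; rewrite subr_eq; apply/eqP.
rewrite -[LHS](binomial_cdfnn n p) /binomial_cdf.
rewrite [X in _ = _ + X](big_ord_widen n.+1 (binomial_pmf n p))//.
rewrite (bigID (fun j : 'I_n.+1 => (j < k.+1)%N)) addrC/=; congr (_ + _).
rewrite [LHS]big_mkcond; apply: eq_bigr => j _.
by rewrite step ltnS -ltnNge; case: ifP; rewrite ?mul1r ?mul0r.
Qed.

End binomial_law.

(** * Optimality of the constant [ln (4 / 3)] *)

Section optimality.
Context {R : realType}.
Implicit Types (n : nat) (p x y : R).

(** The witness is the embedding of [nat] into [R] under [binomial_prob]. *)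
Lemma binomially_distributed_exists n p : 0 <= p <= 1 ->
  exists (d : measure_display) (T : measurableType d) (P : probability T R)
    (X : {RV P >-> R}), binomially_distributed X n p.
Proof.
move=> p01.
pose f (k : nat) : R := k%:R.
have mf : measurable_fun setT f by [].
pose fX := HB.pack_for {mfun nat >-> R} f (isMeasurableFun.Build _ _ _ _ f mf).
exists _, nat, (binomial_prob n p), fX => k _ /=.
rewrite /binomial_prob p01 (_ : [set t | _] = [set k]); last first.
  apply/seteqP; split => j /=; rewrite /f; last by move=> ->.
  by move=> /eqP; rewrite eqr_nat => /eqP.
by rewrite esum_set1// lee_fin binomial_pmf_ge0.
Qed.

(** Take reciprocals in [1 + u <= expR u] at [u = y / (1 - y)], where [1 + u = 1 / (1 - y)]. *)
Lemma onem_ge_expR y : y < 1 -> expR (- (y / (1 - y))) <= 1 - y.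
Proof.
move=> y1; rewrite expRN -[leRHS]invrK lef_pV2 ?posrE ?expR_gt0//; last first.
  by rewrite invr_gt0 subr_gt0.
apply: le_trans (expR_ge1Dx _).
by rewrite le_eqVlt; apply/orP; left; apply/eqP; field; lra.
Qed.

Lemma ln43_lt1 : ln (4 / 3) < 1 :> R.
Proof.
have := @le_ln1Dx R (1 / 3); rewrite (_ : 1 + 1 / 3 = 4 / 3); last by field.
by move=> /(_ ltac:(lra)); lra.
Qed.

Lemma expr_onem_gt_three_quarters x : 0 <= x -> x < ln (4 / 3) ->
  exists2 n, (0 < n)%N & 3 / 4 < (1 - x / n%:R) ^+ n.
Proof.
move=> x0 xc; have c1 := ln43_lt1; set c : R := ln (4 / 3) in xc c1 *.
have cx : 0 < c - x by rewrite subr_gt0.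
(* The power is at least [expR (- (x * n / (n - x)))], and [x * n / (n - x) < c] amounts to
   [n > c * x / (c - x)]. *)
pose n := (Num.truncn (c * x / (c - x))).+1; exists n => //.
have nR : 0 < n%:R :> R by rewrite ltr0n.
have : c * x / (c - x) < n%:R by rewrite truncnS_gt.
rewrite ltr_pdivrMr// => nc.
have n1 : 1 <= n%:R :> R by rewrite ler1n.
have xn1 : x / n%:R < 1 by rewrite ltr_pdivrMr//; lra.
apply: (@lt_le_trans _ _ (expR (- (x / n%:R / (1 - x / n%:R))) ^+ n)); last first.
  by rewrite lerXn2r ?nnegrE ?expR_ge0 ?subr_ge0 ?(ltW xn1)// onem_ge_expR.
rewrite -expRM_natr -[ltLHS]lnK ?posrE; last by lra.
rewrite ltr_expR (_ : 3 / 4 = (4 / 3)^-1); last by field.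
rewrite lnV ?posrE; last by lra.
rewrite mulNr ltrN2 -/c (_ : _ * n%:R = x * n%:R / (n%:R - x)).
  by rewrite ltr_pdivrMr; lra.
by field; apply/andP; split; apply: lt0r_neq0; lra.
Qed.

End optimality.

Theorem theorem1 (R : realType) :
  (forall (n : nat) (p : R), (1 <= n)%N -> ln (4 / 3) / n%:R <= p -> p < 1 ->
     forall (d : measure_display) (T : measurableType d) (P : probability T R)
       (X : {RV P >-> R}), binomially_distributed X n p ->
       ((1 / 4)%:E <= P [set t | ('E_P[X] < (X t)%:E)%E])%E /\
       (P [set t | ('E_P[X] < (X t)%:E)%E] = (1 / 4)%:E ->
          n = 2%N /\ p = 1 / 2)) /\
  (forall c1 : R, c1 < ln (4 / 3) ->
     exists (n : nat) (p : R),
       [/\ (1 <= n)%N, 0 <= p, p < 1, c1 / n%:R <= p &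
         exists (d : measure_display) (T : measurableType d)
           (P : probability T R) (X : {RV P >-> R}),
           binomially_distributed X n p /\
           (P [set t | ('E_P[X] < (X t)%:E)%E] < (1 / 4)%:E)%E]).
Proof.
split=> [n p n0 cp p1 d T P X XB | c1 c1c].
  have p0 : 0 <= p.
    by apply: le_trans cp; rewrite divr_ge0// ltW// ln_gt0//; lra.
  have np0 : 0 <= n%:R * p by rewrite mulr_ge0.
  have npk := truncn_itv np0; set k := Num.truncn _ in npk.
  have kn : (k <= n)%N.
    rewrite -(ler_nat R); case/andP: npk => /le_trans + _; apply.
  by rewrite ger_pMr ?ltr0n// ltW.
  have [ge eq] := binomial_upper_tail_quarter _ _ _ n0 cp p1 npk.
  rewrite (binomial_exceeds_mean _ _ _ _ XB _ kn npk).
  by split; [rewrite lee_fin|move=> [] /eq].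
(* Clamping at 0 keeps [p = x / n] nonnegative when [c1] is negative. The mean is then [x < 1], so
   only the value 0 has to be excluded from the tail. *)
pose x := Num.max c1 0.
have x0 : 0 <= x by rewrite le_max lexx orbT.
have xc : x < ln (4 / 3) by rewrite gt_max c1c ln_gt0//; lra.
have x1 : x < 1 := lt_trans xc ln43_lt1.
have [n n0 lt] := expr_onem_gt_three_quarters _ x0 xc.
have nR : 0 < n%:R :> R by rewrite ltr0n.
have xn0 : 0 <= x / n%:R by rewrite divr_ge0.
have xn1 : x / n%:R < 1 by rewrite ltr_pdivrMr// mul1r (lt_le_trans x1)// ler1n.
exists n, (x / n%:R); split=> //.
  by rewrite ler_pM2r ?invr_gt0// le_max lexx.
have [|d [T [P [X XB]]]] := @binomially_distributed_exists R n (x / n%:R).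
  by rewrite xn0 ltW.
exists d, T, P, X; split=> //.
rewrite (binomial_exceeds_mean _ _ _ _ XB 0)//; last first.
  by rewrite mulrCA divff ?gt_eqF// mulr1 x0.
by rewrite lte_fin binomial_cdf0; lra.
Qed.
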